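(* Let $m,n\ge 1$ and let $p_1,\dots,p_m\ge 1$ be integers with $\sum_{i=1}^m p_i=n$. Let $A\in\mathbb{R}^{m\times n}$ be a simultaneous Volterra-Lyapunov stable matrix with respect to this partition, i.e. there is a diagonal matrix $D\in\mathbb{R}^{m\times m}$ with positive diagonal entries such that every $m$-order squared matrix $S$ of $A$ satisfies $SD+DS^T>0$ (positive definite). Then there exists a block diagonal non-square matrix $K\in\mathbb{R}^{n\times m}$ (of the structure described in the context, with non-negative entries $k_{i,l}$) such that for every diagonal matrix $E=\mathrm{diag}(\varepsilon_{1,1},\dots,\varepsilon_{1,p_1},\dots,\varepsilon_{m,1},\dots,\varepsilon_{m,p_m})\in\mathbb{R}^{n\times n}$ with non-negative diagonal entries, and every non-empty index set $j\subseteq\{1,\dots,m\}$ such that for each $i\in j$ at least one of $\varepsilon_{i,1},\dots,\varepsilon_{i,p_i}$ is non-zero, all eigenvalues of the principal submatrix $[AEK]_j$ have positive real part: $$\mathrm{Re}\{\sigma_i([AEK]_j)\}>0\quad\text{for every } i .$$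
   Context: Partition of columns: given integers $p_1,\dots,p_m\ge 1$ with $\sum_i p_i=n$, the $n$ columns of $A\in\mathbb{R}^{m\times n}$ are relabelled in order as $A=[\boldsymbol{a}_{1,1},\dots,\boldsymbol{a}_{1,p_1},\boldsymbol{a}_{2,1},\dots,\boldsymbol{a}_{2,p_2},\dots,\boldsymbol{a}_{m,1},\dots,\boldsymbol{a}_{m,p_m}]$. $m$-order squared matrices of $A$: the $N=\prod_{i=1}^m p_i$ matrices $[\boldsymbol{a}_{1,\zeta_1},\boldsymbol{a}_{2,\zeta_2},\dots,\boldsymbol{a}_{m,\zeta_m}]\in\mathbb{R}^{m\times m}$ obtained by choosing one column $\boldsymbol{a}_{i,\zeta_i}$, $\zeta_i\in\{1,\dots,p_i\}$, from each group $i$. Block diagonal structure of $K$: $K$ is the $n\times m$ matrix whose $i$-th column has entries $k_{i,1},\dots,k_{i,p_i}$ (all non-negative) in the rows corresponding to group $i$ and zeros in all other rows. Consequently $AEK=[\sum_{l=1}^{p_1}\varepsilon_{1,l}k_{1,l}\boldsymbol{a}_{1,l},\dots,\sum_{l=1}^{p_m}\varepsilon_{m,l}k_{m,l}\boldsymbol{a}_{m,l}]\in\mathbb{R}^{m\times m}$. For a square matrix $M\in\mathbb{R}^{m\times m}$ and a non-empty index set $j\subseteq\{1,\dots,m\}$ (a $k$-tuple of distinct integers in $1,\dots,m$), $[M]_j$ denotes the principal submatrix of $M$ with rows and columns indexed by $j$; $\sigma_i(\cdot)$ denotes the $i$-th eigenvalue. For a symmetric matrix, $>0$ means positive definite. 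*)

(* Defs.v *)
From HB Require Import structures.
From mathcomp Require Import all_boot all_order all_algebra.
From mathcomp Require Import reals.
Set Implicit Arguments.
Unset Strict Implicit.
Unset Printing Implicit Defensive.

Import Order.TTheory GRing.Theory Num.Theory.
Local Open Scope ring_scope.

(* Index, among n columns, of the l-th column of the i-th group; tagnat.Rank
   is the lexicographic numbering, i.e. p 0 + ... + p (i - 1) + l. *)
Definition group_idx (m n : nat) (p : 'I_m -> nat)
    (pn : (\sum_(i < m) p i)%N = n) (i : 'I_m) (l : 'I_(p i)) : 'I_n :=
  cast_ord pn (tagnat.Rank i l).

Definition squared_mx (R : realType) (m n : nat) (p : 'I_m -> nat)
    (pn : (\sum_(i < m) p i)%N = n) (A : 'M[R]_(m, n))
    (zeta : forall i : 'I_m, 'I_(p i)) : 'M[R]_m :=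
  \matrix_(r < m, i < m) A r (group_idx pn (zeta i)).

Definition posdef_mx (R : realType) (m : nat) (M : 'M[R]_m) : Prop :=
  M^T = M /\
  forall v : 'cV[R]_m, v != 0 -> 0 < (v^T *m M *m v) 0 0.

(* D does not depend on the choice of S. *)
Definition simultaneous_VL_stable (R : realType) (m n : nat) (p : 'I_m -> nat)
    (pn : (\sum_(i < m) p i)%N = n) (A : 'M[R]_(m, n)) : Prop :=
  exists d : 'rV[R]_m,
    (forall i : 'I_m, 0 < d 0 i) /\
    forall zeta : (forall i : 'I_m, 'I_(p i)),
      let S := squared_mx pn A zeta in
      posdef_mx (S *m diag_mx d + diag_mx d *m S^T).

Definition block_diag_nonneg (R : realType) (m n : nat) (p : 'I_m -> nat)
    (pn : (\sum_(i < m) p i)%N = n) (K : 'M[R]_(n, m)) : Prop :=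
  (forall (i : 'I_m) (l : 'I_(p i)), 0 <= K (group_idx pn l) i) /\
  (forall (i i' : 'I_m) (l : 'I_(p i)), i' != i -> K (group_idx pn l) i' = 0).

Definition principal_submx (T : Type) (m : nat) (M : 'M[T]_m)
    (j : {set 'I_m}) : 'M[T]_#|j| :=
  \matrix_(a, b) M (enum_val a) (enum_val b).

(* Main.v *)
Require Import Defs.
From mathcomp Require Import all_boot all_order all_algebra.
From mathcomp Require Import reals complex ring.
Set Implicit Arguments.
Unset Strict Implicit.
Unset Printing Implicit Defensive.
Import Order.TTheory GRing.Theory Num.Theory.
Local Open Scope ring_scope.

(** Take for [K] the block diagonal matrix all of whose block entries are [1].
    Column [i] of [A E K] is then a non-negative combination of the columns of
    group [i], and, when the total weight [s_i] of the group is positive,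
    it is [s_i] times a convex combination [c_i] of them.

    Stability of the [m]-order squared matrices says that, for the fixed
    inner product [<y, x>_d = sum_i d_i y_i x_i], every row vector [x != 0]
    satisfies [<x S, x>_d > 0].  This passes to matrices whose columns are convex
    combinations: the [i]-th term [d_i x_i (x . c_i)] is an average of the
    numbers [d_i x_i (x . a_(i,l))], hence at least the smallest of them, and
    choosing in every group a column which attains the minimum gives one squared
    matrix [S], depending on [x], with [<x S, x>_d] as a lower bound
    ([weighted_dot_group_sums_gt0]).  The factors [s_i] are absorbed by
    replacing the weights [d_i] with [d_i / s_i], and the rows and columns
    outside [j] disappear when [x] vanishes outside [j].  So the principal
    submatrix indexed by [j] is positive for an inner product with positive
    weights, and a matrix with this property has its spectrum in the open right
    half-plane ([eigenvalue_Re_gt0]). *)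

Definition weighted_dot (R : comNzRingType) (k : nat) (t : 'I_k -> R)
    (y x : 'rV[R]_k) : R :=
  \sum_i t i * (y 0 i * x 0 i).

Lemma weighted_dot_gt0 (R : realDomainType) (k : nat) (t : 'I_k -> R)
    (x : 'rV[R]_k) :
  (forall i, 0 < t i) -> x != 0 -> 0 < weighted_dot t x x.
Proof.
move=> t_gt0 /rV0Pn[i xi_neq0].
rewrite /weighted_dot (bigD1 i) //= ltr_pwDl //.
  by rewrite mulr_gt0 // -expr2 exprn_even_gt0.
by apply: sumr_ge0 => l _; rewrite mulr_ge0 ?(ltW (t_gt0 _)) // -expr2 sqr_ge0.
Qed.

(** For a left eigenvector [x + iy] with eigenvalue [a + ib], the sum of the
    forms at [x] and [y] is [a (<x, x> + <y, y>)], because the terms in [b]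
    cancel by symmetry of the inner product. *)
Lemma eigenvalue_Re_gt0 (R : rcfType) (k : nat) (t : 'I_k -> R) (M : 'M[R]_k) :
  (forall i, 0 < t i) ->
  (forall x : 'rV_k, x != 0 -> 0 < weighted_dot t (x *m M) x) ->
  forall lambda : R[i],
    eigenvalue (map_mx (real_complex R) M) lambda -> 0 < complex.Re lambda.
Proof.
move=> t_gt0 M_gt0 [a b] /eigenvalueP[v vM v_neq0] /=.
pose x : 'rV[R]_k := \row_i complex.Re (v 0 i).
pose y : 'rV[R]_k := \row_i complex.Im (v 0 i).
have vMi i : ((x *m M) 0 i +i* (y *m M) 0 i)%C = ((a +i* b) * v 0 i)%C.
  move/rowP/(_ i): vM; rewrite !mxE => <-.
  apply/eqP; rewrite eq_complex /= (raddf_sum (@complex.Re R)).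
  rewrite (raddf_sum (@complex.Im R)).
  apply/andP; split; apply/eqP; apply: eq_bigr => r _; rewrite !mxE.
    by case: (v 0 r) => u w /=; rewrite mulr0 subr0.
  by case: (v 0 r) => u w /=; rewrite mulr0 add0r mulrC.
have xMi i : (x *m M) 0 i = a * x 0 i - b * y 0 i.
  by have /= -> := congr1 (@complex.Re R) (vMi i); rewrite !mxE; case: (v 0 i).
have yMi i : (y *m M) 0 i = a * y 0 i + b * x 0 i.
  have /= -> := congr1 (@complex.Im R) (vMi i); rewrite !mxE.
  by case: (v 0 i).
have sumE : weighted_dot t (x *m M) x + weighted_dot t (y *m M) y =
    a * (weighted_dot t x x + weighted_dot t y y).
  rewrite /weighted_dot -!big_split mulr_sumr; apply: eq_bigr => i _ /=.
  by rewrite xMi yMi; ring.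
(* One of [x] and [y] may be zero, so positivity is only used on the sum. *)
have ge0 (f : 'rV[R]_k -> R) : f 0 = 0 ->
    (forall z, z != 0 -> 0 < f z) -> forall z, 0 <= f z.
  by move=> f0 fP z; have [->|/fP/ltW//] := eqVneq z 0; rewrite f0.
have dot0 u : weighted_dot t u 0 = 0.
  by apply: big1 => i _; rewrite mxE !mulr0.
have xy_neq0 : (x != 0) || (y != 0).
  rewrite -negb_and; apply: contra v_neq0 => /andP[/eqP x0 /eqP y0].
  apply/eqP/rowP => i; move/rowP/(_ i): x0; move/rowP/(_ i): y0.
  by rewrite !mxE; case: (v 0 i) => u w /= -> ->.
have pos (f : 'rV[R]_k -> R) : f 0 = 0 ->
    (forall z, z != 0 -> 0 < f z) -> 0 < f x + f y.
  move=> f0 fP; case/orP: xy_neq0 => /fP fz.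
    by rewrite ltr_pwDl // ge0.
  by rewrite ltr_wpDl // ge0.
have N_gt0 : 0 < weighted_dot t x x + weighted_dot t y y.
  by apply: (pos (fun z => weighted_dot t z z)) => // z; exact: weighted_dot_gt0.
rewrite -(pmulr_lgt0 _ N_gt0) -sumE.
exact: (pos (fun z => weighted_dot t (z *m M) z)).
Qed.

(** The form [<x S, x>_d] has matrix [S D], and [S D + D S^T] is twice the
    symmetric part of that matrix, so its quadratic form is [2 <x S, x>_d]. *)
Lemma posdef_lyapunov_weighted_dot (R : realType) (m : nat) (S : 'M[R]_m)
    (d x : 'rV[R]_m) :
  posdef_mx (S *m diag_mx d + diag_mx d *m S^T) -> x != 0 ->
  0 < weighted_dot (d 0) (x *m S) x.
Proof.
move=> [_ posS] x_neq0.
have /posS : x^T != 0 by rewrite -(inj_eq (@trmx_inj _ _ _)) trmxK trmx0.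
have formE : (x *m (S *m diag_mx d) *m x^T) 0 0 = weighted_dot (d 0) (x *m S) x.
  rewrite mulmxA mul_mx_diag mxE; apply: eq_bigr => i _.
  by rewrite !mxE mulrAC mulrC.
have tr11 (N : 'M[R]_1) : N^T 0 0 = N 0 0 by rewrite mxE.
have -> : diag_mx d *m S^T = (S *m diag_mx d)^T by rewrite trmx_mul tr_diag_mx.
rewrite trmxK mulmxDr mulmxDl mxE.
have -> : (x *m (S *m diag_mx d)^T *m x^T) 0 0 =
    (x *m (S *m diag_mx d) *m x^T) 0 0.
  by rewrite -[LHS]tr11 trmx_mul trmxK trmx_mul trmxK mulmxA.
by rewrite formE -mulr2n pmulrn_lgt0.
Qed.

(** Zero extension of vectors lets the positivity of a principal submatrix be
    read off the form of the whole matrix. *)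
Lemma weighted_dot_principal_submx (R : comNzRingType) (m : nat)
    (j : {set 'I_m}) (t : 'I_m -> R) (M : 'M[R]_m) (x : 'rV[R]_m) :
  (forall i, i \notin j -> x 0 i = 0) ->
  weighted_dot (t \o enum_val)
    ((\row_(a < #|j|) x 0 (enum_val a)) *m principal_submx M j)
    (\row_a x 0 (enum_val a)) = weighted_dot t (x *m M) x.
Proof.
move=> x_out.
have sum_in (F : 'I_m -> R) : (forall i, x 0 i = 0 -> F i = 0) ->
    \sum_(a < #|j|) F (enum_val a) = \sum_i F i.
  move=> F0; rewrite -(big_enum_val F) [RHS](bigID (mem j)) /=.
  by rewrite [X in _ + X]big1 ?addr0 // => i /x_out/F0.
rewrite /weighted_dot -[RHS]sum_in => [|i ->]; last by rewrite !mulr0.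
apply: eq_bigr => a _; rewrite !mxE /=; congr (_ * (_ * _)).
rewrite -sum_in => [|i ->]; last by rewrite mul0r.
by apply: eq_bigr => r _; rewrite !mxE.
Qed.

Lemma big_group_idx (R : nmodType) (m n : nat) (p : 'I_m -> nat)
    (pn : (\sum_(i < m) p i)%N = n) (F : 'I_n -> R) :
  \sum_c F c = \sum_i \sum_(l < p i) F (group_idx pn l).
Proof.
rewrite sig_big_dep /=; case: _ / pn F => F.
rewrite (reindex _ (tagnat.rank_bij_on (p_ := p))) /=.
by apply: eq_bigr => q _; rewrite tagnat.rankE /group_idx cast_ord_id.
Qed.

Definition group_indicator (R : pzSemiRingType) (m n : nat) (p : 'I_m -> nat)
    (pn : (\sum_(i < m) p i)%N = n) : 'M[R]_(n, m) :=
  \matrix_(c, i) (tagnat.sig1 (cast_ord (esym pn) c) == i)%:R.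

Lemma group_indicatorE (R : pzSemiRingType) (m n : nat) (p : 'I_m -> nat)
    (pn : (\sum_(i < m) p i)%N = n) (i i' : 'I_m) (l : 'I_(p i)) :
  group_indicator R pn (group_idx pn l) i' = (i == i')%:R.
Proof. by rewrite mxE /group_idx cast_ordK tagnat.Rank1K. Qed.

Lemma group_indicator_block_diag (R : realType) (m n : nat) (p : 'I_m -> nat)
    (pn : (\sum_(i < m) p i)%N = n) :
  block_diag_nonneg pn (group_indicator R pn).
Proof.
split=> [i l|i i' l i'_neq]; rewrite group_indicatorE ?ler0n //.
by rewrite eq_sym (negPf i'_neq).
Qed.

Lemma mulmx_diag_group_indicator (R : comNzRingType) (k m n : nat)
    (p : 'I_m -> nat) (pn : (\sum_(i < m) p i)%N = n) (B : 'M[R]_(k, n))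
    (eps : 'rV[R]_n) (r : 'I_k) (i : 'I_m) :
  (B *m diag_mx eps *m group_indicator R pn) r i =
  \sum_(l < p i) eps 0 (group_idx pn l) * B r (group_idx pn l).
Proof.
rewrite mul_mx_diag mxE (big_group_idx pn) (bigD1 i) //=.
rewrite [X in _ + X]big1 ?addr0 => [|i' i'_neq].
  apply: eq_bigr => l _.
  by rewrite group_indicatorE eqxx mulr1 mxE mulrC.
by apply: big1 => l _; rewrite group_indicatorE (negPf i'_neq) mulr0.
Qed.

(** The core of the argument: for a fixed [x] the least favourable column can
    be chosen independently in each group, so no expansion of the product of
    the convex combinations into squared matrices is needed. *)
Lemma weighted_dot_group_sums_gt0 (R : realType) (m n : nat) (p : 'I_m -> nat)
    (hp : forall i, (0 < p i)%N) (pn : (\sum_(i < m) p i)%N = n)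
    (A : 'M[R]_(m, n)) (d : 'rV[R]_m) (eps : 'rV[R]_n) (x : 'rV[R]_m) :
  let s i := \sum_(l < p i) eps 0 (group_idx pn l) in
  (forall zeta, let S := squared_mx pn A zeta in
     posdef_mx (S *m diag_mx d + diag_mx d *m S^T)) ->
  (forall c, 0 <= eps 0 c) ->
  (forall i, x 0 i != 0 -> 0 < s i) ->
  x != 0 ->
  0 < weighted_dot (fun i => d 0 i / s i)
        (x *m (A *m diag_mx eps *m group_indicator R pn)) x.
Proof.
move=> s posA eps_ge0 s_gt0 x_neq0.
pose f i (l : 'I_(p i)) := d 0 i * ((x *m A) 0 (group_idx pn l) * x 0 i).
(* The column of group [i] that is least favourable to positivity at [x]. *)
pose zeta i := [arg min_(l < Ordinal (hp i)) f i l]%O.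
have zeta_min i l : f i (zeta i) <= f i l.
  by rewrite /zeta; case: arg_minP => // z _; apply.
have xS i : (x *m squared_mx pn A zeta) 0 i = (x *m A) 0 (group_idx pn (zeta i)).
  by rewrite !mxE; apply: eq_bigr => r _; rewrite mxE.
apply: lt_le_trans (posdef_lyapunov_weighted_dot (posA zeta) x_neq0) _.
apply: ler_sum => i _; rewrite xS -/(f i (zeta i)).
have [xi0|/s_gt0 si_gt0] := eqVneq (x 0 i) 0.
  by rewrite /f xi0 !mulr0.
rewrite !mulmxA mulmx_diag_group_indicator mulrAC ler_pdivlMr //.
rewrite mulr_sumr mulr_suml mulr_sumr; apply: ler_sum => l _.
have -> : d 0 i * (eps 0 (group_idx pn l) * (x *m A) 0 (group_idx pn l) * x 0 i)
    = eps 0 (group_idx pn l) * f i l by rewrite /f; ring.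
by rewrite mulrC ler_wpM2l.
Qed.

Theorem lemma3 (R : realType) (m n : nat) (hm : (1 <= m)%N) (hn : (1 <= n)%N)
    (p : 'I_m -> nat) (hp : forall i : 'I_m, (1 <= p i)%N)
    (pn : (\sum_(i < m) p i)%N = n)
    (A : 'M[R]_(m, n)) (hA : simultaneous_VL_stable pn A) :
  exists K : 'M[R]_(n, m),
    block_diag_nonneg pn K /\
    forall eps : 'rV[R]_n,
      (forall c : 'I_n, 0 <= eps 0 c) ->
      forall j : {set 'I_m},
        j != set0 ->
        (forall i : 'I_m, i \in j ->
           exists l : 'I_(p i), eps 0 (group_idx pn l) != 0) ->
        forall lambda : R[i],
          eigenvalue (map_mx (real_complex R)
                        (principal_submx (A *m diag_mx eps *m K) j)) lambda ->
          0 < complex.Re lambda.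
Proof.
case: hA => d [d_gt0 posA].
exists (group_indicator R pn); split; first exact: group_indicator_block_diag.
move=> eps eps_ge0 j _ eps_neq0.
pose s i := \sum_(l < p i) eps 0 (group_idx pn l).
have s_gt0 i : i \in j -> 0 < s i.
  move=> /eps_neq0[l eps_l]; rewrite /s (bigD1 l) //= ltr_pwDl //.
    by rewrite lt_def eps_l eps_ge0.
  exact: sumr_ge0.
pose t i := d 0 i / s i.
apply: (@eigenvalue_Re_gt0 _ _ (t \o enum_val)) => [a|u u_neq0] /=.
  by rewrite divr_gt0 // s_gt0 // enum_valP.
(* [x] is the extension of [u] by zero: at most one [a] contributes to each
   entry. *)
pose x : 'rV[R]_m := \row_i \sum_(a | enum_val a == i) u 0 a.
have xE a : x 0 (enum_val a) = u 0 a.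
  by rewrite mxE (eq_bigl (pred1 a)) ?big_pred1_eq // => b;
    rewrite /= (inj_eq enum_val_inj).
have x_out i : i \notin j -> x 0 i = 0.
  move=> iNj; rewrite mxE big1 // => a /eqP ai.
  by rewrite -ai enum_valP in iNj.
have uE : u = \row_a x 0 (enum_val a) by apply/rowP => a; rewrite mxE xE.
rewrite uE weighted_dot_principal_submx //.
apply: weighted_dot_group_sums_gt0 => // [i xi_neq0|].
  by apply: s_gt0; apply: contraNT xi_neq0 => /x_out ->.
apply: contraNneq u_neq0 => x0; rewrite uE x0.
by apply/eqP/rowP => a; rewrite !mxE.
Qed.
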